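(* Let $M\subseteq\mathbb R^4$ be a connected open set with coordinates $(x,r,x^3,x^4)$, let $h=h(x,x^3,x^4)$ and $f=f(x^3,x^4)$ be nowhere vanishing smooth functions on $M$, and let $g$ be the generalized pp-wave metric $$ds^2=-2h\,(dx)^2+2\,dx\,dr-\tfrac12 f\,[(dx^3)^2+(dx^4)^2].$$ If $f_3^2+f_4^2-f(f_{33}+f_{44})=0$ on $M$, then $g$ is a pp-wave metric.
   Context: Coordinates $(x,r,x^3,x^4)$ are numbered $1,2,3,4$; a subscript on $f$ or $h$ denotes a partial derivative with respect to the coordinate so numbered. $R_{ijkl}$ are the components of the $(0,4)$ Riemann curvature tensor of the Levi-Civita connection. A Brinkmann-wave is a Lorentzian manifold admitting a nonzero parallel (covariantly constant) null vector field. A Brinkmann-wave is called a pp-wave if its curvature tensor satisfies ${R_{ij}}^{pq}R_{pqkl}=0$, indices being raised with $g$. *)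

(* Defs.v *)
From HB Require Import structures.
From mathcomp Require Import all_boot all_order all_algebra.
From mathcomp Require Import all_classical all_reals all_analysis.

Set Implicit Arguments.
Unset Strict Implicit.
Unset Printing Implicit Defensive.

Import Order.TTheory GRing.Theory Num.Theory.
Import numFieldNormedType.Exports.

Local Open Scope classical_set_scope.
Local Open Scope ring_scope.

Section Calculus.
Variables (R : realType) (n : nat).

Definition partial (i : 'I_n) (F : 'rV[R]_n -> R) : 'rV[R]_n -> R :=
  fun p => 'D_(delta_mx 0 i) F p.

(* C^oo on M.  Meant for an open M: the derivatives at p are those of the
   total function F, which then only depend on the restriction of F to M. *)
Definition smooth_on (M : set 'rV[R]_n) (F : 'rV[R]_n -> R) : Prop :=
  forall (s : seq 'I_n) (p : 'rV[R]_n), M p ->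
    {for p, continuous (foldr partial F s)} /\
    (forall i : 'I_n, derivable (foldr partial F s) p (delta_mx 0 i)).

Definition depends_only_on (M : set 'rV[R]_n) (A : {set 'I_n})
    (F : 'rV[R]_n -> R) : Prop :=
  forall p q, M p -> M q -> (forall i, i \in A -> p 0 i = q 0 i) -> F p = F q.

End Calculus.

Section LeviCivita.
Variables (R : realType) (n : nat).

(* g p i j is the component g_ij at p in the standard coordinates. *)
Variable g : 'rV[R]_n -> 'M[R]_n.

Definition metric_inv (p : 'rV[R]_n) : 'M[R]_n := invmx (g p).

(* christoffel k i j is Gamma^k_ij. *)
Definition christoffel (k i j : 'I_n) (p : 'rV[R]_n) : R :=
  2^-1 * \sum_l metric_inv p k l *
    (partial i (fun q => g q j l) p + partial j (fun q => g q i l) p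
     - partial l (fun q => g q i j) p).

(* The l-th component of R(d_i, d_j) d_k, where
   R(X, Y) = [nabla_X, nabla_Y] - nabla_[X, Y]. *)
Definition riemann_up (i j k l : 'I_n) (p : 'rV[R]_n) : R :=
  partial i (christoffel l j k) p - partial j (christoffel l i k) p
  + \sum_m (christoffel l i m p * christoffel m j k p
            - christoffel l j m p * christoffel m i k p).

(* R_ijkl = g(R(d_i, d_j) d_k, d_l). *)
Definition riemann (i j k l : 'I_n) (p : 'rV[R]_n) : R :=
  \sum_m riemann_up i j k m p * g p m l.

(* R_ij^pq. *)
Definition riemann_raised (i j p q : 'I_n) (x : 'rV[R]_n) : R :=
  \sum_a \sum_b metric_inv x p a * metric_inv x q b * riemann i j a b x.

(* The k-th component of nabla_(d_i) V. *)
Definition cov_deriv (V : 'rV[R]_n -> 'rV[R]_n) (i k : 'I_n)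
    (p : 'rV[R]_n) : R :=
  partial i (fun q => V q 0 k) p + \sum_j christoffel k i j p * V p 0 j.

Definition parallel_on (M : set 'rV[R]_n) (V : 'rV[R]_n -> 'rV[R]_n) : Prop :=
  forall p, M p -> forall i k, cov_deriv V i k p = 0.

Definition null_on (M : set 'rV[R]_n) (V : 'rV[R]_n -> 'rV[R]_n) : Prop :=
  forall p, M p -> \sum_i \sum_j g p i j * V p 0 i * V p 0 j = 0.

End LeviCivita.

Section Waves.
Variables (R : realType) (n : nat).
Variables (M : set 'rV[R]_n.+1) (g : 'rV[R]_n.+1 -> 'M[R]_n.+1).

(* diag(1, -1, ..., -1) *)
Definition minkowski_mx : 'M[R]_n.+1 :=
  diag_mx (\row_j (if j == ord0 then 1 else - 1)).

Definition congruent_mx (A B : 'M[R]_n.+1) : Prop :=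
  exists2 P : 'M[R]_n.+1, P \in unitmx & P *m A *m P^T = B.

(* Both sign conventions (+ - ... -) and (- + ... +) count as Lorentzian, but
   the signature has to be the same at all points. *)
Definition lorentzian_on : Prop :=
  [/\ forall i j, smooth_on M (fun p => g p i j),
      forall p, M p -> (g p)^T = g p
    & (forall p, M p -> congruent_mx (g p) minkowski_mx) \/
      (forall p, M p -> congruent_mx (g p) (- minkowski_mx))].

(* On a connected domain a parallel field that is nonzero at one point
   vanishes nowhere, so "nonzero" is required pointwise. *)
Definition brinkmann_wave_on : Prop :=
  lorentzian_on /\
  exists V : 'rV[R]_n.+1 -> 'rV[R]_n.+1,
    [/\ forall k, smooth_on M (fun p => V p 0 k),
        forall p, M p -> V p != 0,
        null_on g M V
      & parallel_on g M V].

Definition pp_wave_on : Prop :=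
  brinkmann_wave_on /\
  forall x, M x -> forall i j k l,
    \sum_p \sum_q riemann_raised g i j p q x * riemann g p q k l x = 0.

End Waves.

(* The coordinates (x, r, x^3, x^4), numbered 1, 2, 3, 4. *)
Definition c1 : 'I_4 := @Ordinal 4 0 isT.
Definition c2 : 'I_4 := @Ordinal 4 1 isT.
Definition c3 : 'I_4 := @Ordinal 4 2 isT.
Definition c4 : 'I_4 := @Ordinal 4 3 isT.

(* The cross term 2 dx dr contributes 1 to both g_12 and g_21. *)
Definition gen_pp_metric (R : realType) (h f : 'rV[R]_4 -> R)
    (p : 'rV[R]_4) : 'M[R]_4 :=
  - 2 * h p *: delta_mx c1 c1 + (delta_mx c1 c2 + delta_mx c2 c1)
  - 2^-1 * f p *: (delta_mx c3 c3 + delta_mx c4 c4).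

(* Main.v *)
Require Import Defs.
From HB Require Import structures.
From mathcomp Require Import all_boot all_order all_algebra.
From mathcomp Require Import all_classical all_reals all_analysis.
From mathcomp Require Import ring lra.
Import Order.TTheory GRing.Theory Num.Theory.
Import numFieldNormedType.Exports.
Set Implicit Arguments.
Unset Strict Implicit.
Unset Printing Implicit Defensive.
Local Open Scope classical_set_scope.
Local Open Scope ring_scope.

(** Neither [h] nor [f] depends on the coordinate [r], and the only entry of the
    metric involving [dr] is constant. Hence every Christoffel symbol with lower
    index [2] vanishes ([christoffel_left2], [christoffel_right2]): the
    coordinate field of [r] is parallel, and it is null because [g_22 = 0]. The
    metric is Lorentzian by an explicit change of frame ([metric_congruent]); the
    sign of [f], which decides between the two sign conventions, is constant on
    the connected set [M] ([f_constant_sign]).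

    For the curvature, a component [R_ijab] vanishes as soon as [i] or [j] is
    [2]. It also vanishes when [a] and [b] are distinct and both different from
    [1] ([riemann_eq0_avoiding1]): the symbols [Gamma^1_ij] are zero, the
    coordinate field of [r] is parallel, and what remains is the curvature of the
    conformally flat transverse plane, whose Gauss curvature is zero exactly
    because the assumed equation makes [ln |f|] harmonic ([riemann_up_34]). Now
    the only nonzero entry of the inverse metric in the column of [1] is [g^21],
    so raising an index [1] produces an index [2]. Each nonzero component of
    [R_ij^ab] with [a] and [b] distinct thus has an upper index [2], and is
    multiplied by [R_abkl = 0] in the contraction; for [a] equal to [b] the
    factor [R_abkl] is zero by antisymmetry ([curvature_square_eq0]). *)

(** * Derivatives on an open set *)

Section Locality.
Context (R : realType) (n : nat) (M : set 'rV[R]_n).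
Hypothesis M_open : open M.
Implicit Types (F G : 'rV[R]_n -> R) (A : {set 'I_n}) (p : 'rV[R]_n).

Lemma near_eq_on F G p : (forall q, M q -> F q = G q) -> M p ->
  \forall q \near p, F q = G q.
Proof.
move=> FG Mp.
by apply: filterS (open_nbhs_nbhs (conj M_open Mp)) => q /FG.
Qed.

(** A partial derivative at an interior point of [M] sees only the values on [M].
    This is what allows every identity below to be differentiated although it
    is known on [M] only: off [M], where [f] may vanish, the formulas for the
    inverse metric and the Christoffel symbols break down. *)
Lemma eq_partial F G i p : (forall q, M q -> F q = G q) -> M p ->
  partial i F p = partial i G p.
Proof. by move=> FG Mp; apply/near_eq_derive/near_eq_on. Qed.

Lemma partialD F G i p : derivable F p (delta_mx 0 i) ->
  derivable G p (delta_mx 0 i) ->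
  partial i (fun q => F q + G q) p = partial i F p + partial i G p.
Proof. by move=> dF dG; rewrite /partial -deriveD. Qed.

Lemma partialZ F (a : R) i p : derivable F p (delta_mx 0 i) ->
  partial i (fun q => a * F q) p = a * partial i F p.
Proof. by move=> dF; rewrite /partial -[RHS]deriveZ. Qed.

Lemma partialM F G i p : derivable F p (delta_mx 0 i) ->
  derivable G p (delta_mx 0 i) ->
  partial i (fun q => F q * G q) p = F p * partial i G p + G p * partial i F p.
Proof. by move=> dF dG; rewrite /partial -[RHS](deriveM dF dG). Qed.

Lemma partialV F i p : F p != 0 -> derivable F p (delta_mx 0 i) ->
  partial i (fun q => (F q)^-1) p = - (F p)^-2 * partial i F p.
Proof. by move=> F0 dF; exact: deriveV. Qed.

Lemma partial_cst (a : R) i p : partial i (fun=> a : R) p = 0.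
Proof. by rewrite /partial -[LHS]/('D_(delta_mx 0 i) (cst a) p) derive_cst. Qed.

Lemma smooth_on_partial F i : smooth_on M F -> smooth_on M (partial i F).
Proof.
move=> smF s p /(smF (rcons s i)); rewrite foldr_rcons; exact.
Qed.

Lemma smooth_on_derivable F i p : smooth_on M F -> M p ->
  derivable F p (delta_mx 0 i).
Proof. by move=> smF /(smF [::])[_]; apply. Qed.

Lemma smooth_on_cst (a : R) : smooth_on M (fun=> a).
Proof.
have foldE : forall (s : seq 'I_n) , exists b : R,
    foldr (@partial R n) (fun=> a) s = cst b.
  elim=> [|i s [b /= ->]]; first by exists a.
  by exists 0; apply/funext => q; exact: partial_cst.
move=> s p Mp; have [b ->] := foldE s; split; first exact: cst_continuous.
by move=> i; apply: derivable_cst.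
Qed.

Lemma smooth_onD F G : smooth_on M F -> smooth_on M G ->
  smooth_on M (fun q => F q + G q).
Proof.
move=> smF smG s.
have sE : forall q, M q -> foldr (@partial R n) (fun q => F q + G q) s q
   = foldr (@partial R n) F s q + foldr (@partial R n) G s q.
  elim: s => [|i s IH] //= q Mq; rewrite (eq_partial _ IH)// partialD//.
    by have [_] := smF s q Mq; apply.
  by have [_] := smG s q Mq; apply.
move=> p Mp.
have nE := near_eq_on (fun q Mq => esym (sE q Mq)) Mp.
have [cF dF] := smF s p Mp; have [cG dG] := smG s p Mp; split.
  rewrite /prop_for /continuous_at (sE p Mp).
  apply: cvg_trans (near_eq_cvg nE) _; exact: cvgD.
by move=> i; apply: near_eq_derivable nE _; apply: derivableD.
Qed.

Lemma smooth_onZ F (a : R) : smooth_on M F -> smooth_on M (fun q => a * F q).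
Proof.
move=> smF s.
have sE : forall q, M q -> foldr (@partial R n) (fun q => a * F q) s q
   = a * foldr (@partial R n) F s q.
  elim: s => [|i s IH] //= q Mq; rewrite (eq_partial _ IH)// partialZ//.
  by have [_] := smF s q Mq; apply.
move=> p Mp.
have nE := near_eq_on (fun q Mq => esym (sE q Mq)) Mp.
have [cF dF] := smF s p Mp; split.
  rewrite /prop_for /continuous_at (sE p Mp).
  by apply: cvg_trans (near_eq_cvg nE) _; apply: cvgZl_tmp.
by move=> i; apply: near_eq_derivable nE _; apply: derivableZ.
Qed.

(** If [p] and [q] agree on the coordinates in [A], then near [p] the function [F]
    coincides with its translate by [q - p], and the derivative of that translate
    at [p] is the derivative of [F] at [q]. *)
Lemma depends_only_on_partial A F i : depends_only_on M A F ->
  depends_only_on M A (partial i F).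
Proof.
move=> depF p q Mp Mq pq.
have pE : p + (q - p) = q by rewrite addrC subrK.
transitivity (partial i (fun x => F (x + (q - p))) p); last first.
  have shiftE : (fun x => F (x + (q - p))) \o shift p = F \o shift q.
    by apply/funext => x /=; rewrite -addrA pE.
  by rewrite /partial /derive shiftE pE.
apply: near_eq_derive; near=> x; apply: depF.
- by near: x; exact: (open_nbhs_nbhs (conj M_open Mp)).
- near: x.
  have : (fun x => x + (q - p)) x @[x --> p] --> p + (q - p).
    exact: (cvgD (@cvg_id _ (nbhs p)) (cvg_cst (q - p))).
  by apply; rewrite pE; exact: (open_nbhs_nbhs (conj M_open Mq)).
- by move=> j jA; rewrite !mxE pq// subrr addr0.
Unshelve. all: by end_near. Qed.

(** The difference quotient in a direction outside [A] vanishes near [0]. *)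
Lemma partial_eq0 A F i p : depends_only_on M A F -> i \notin A -> M p ->
  partial i F p = 0.
Proof.
move=> depF iA Mp; rewrite /partial /derive; apply: cvg_lim => //.
apply: cvg_trans (cvg_cst 0).
apply: near_eq_cvg; apply: cvg_within; near=> t => /=.
rewrite (depF p (t *: delta_mx 0 i + p)) ?subrr ?scaler0//.
- near: t.
  have : t *: (delta_mx 0 i : 'rV[R]_n) + p @[t --> (0 : R)]
      --> 0 *: (delta_mx 0 i : 'rV[R]_n) + p.
    exact: (cvgD (cvgZr_tmp (@cvg_id _ (nbhs 0))) (cvg_cst p)).
  by apply; rewrite scale0r add0r; exact: (open_nbhs_nbhs (conj M_open Mp)).
- move=> j jA; rewrite !mxE eqxx /=; case: eqP => [ji|_].
    by rewrite -ji jA in iA.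
  by rewrite mulr0 add0r.
Unshelve. all: try exact: dnbhs_filter. all: by end_near. Qed.

End Locality.

(** * Symmetries of a general metric *)

Section Geometry.
Context (R : realType) (n : nat) (M : set 'rV[R]_n) (g : 'rV[R]_n -> 'M[R]_n).
Hypothesis M_open : open M.

(** The Christoffel symbols are an expression in the metric entries and their
    first derivatives, so they inherit the symmetry of the metric. *)
Lemma depends_only_on_christoffel (A : {set 'I_n}) :
  (forall i j, depends_only_on M A (fun p => g p i j)) ->
  forall k i j, depends_only_on M A (christoffel g k i j).
Proof.
move=> depg k i j p q Mp Mq pq; rewrite /christoffel /metric_inv.
have -> : g p = g q by apply/matrixP => a b; exact: depg.
congr (_ * _); apply: eq_bigr => l _; congr (_ * _).
by do ![congr (_ + _) | congr (- _)];
  exact: (depends_only_on_partial M_open _ (depg _ _)).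
Qed.

Lemma riemann_up_anti i j k l p :
  riemann_up g i j k l p = - riemann_up g j i k l p.
Proof.
rewrite /riemann_up opprD opprB; congr (_ + _).
by rewrite -sumrN; apply: eq_bigr => m _; rewrite opprB.
Qed.

Lemma riemann_anti i j k l p : riemann g i j k l p = - riemann g j i k l p.
Proof.
rewrite /riemann -sumrN; apply: eq_bigr => m _.
by rewrite riemann_up_anti mulNr.
Qed.

Lemma riemann_diag12 i k l p : riemann g i i k l p = 0.
Proof. by have := riemann_anti i i k l p; lra. Qed.

End Geometry.

(** * Case analysis on the four coordinates *)

Lemma ord4P (P : 'I_4 -> Prop) : P c1 -> P c2 -> P c3 -> P c4 -> forall i, P i.
Proof.
move=> P1 P2 P3 P4; case=> -[|[|[|[|//]]]] i.
- by rewrite (_ : Ordinal i = c1)//; exact: val_inj.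
- by rewrite (_ : Ordinal i = c2)//; exact: val_inj.
- by rewrite (_ : Ordinal i = c3)//; exact: val_inj.
- by rewrite (_ : Ordinal i = c4)//; exact: val_inj.
Qed.

Lemma big_ord4 (V : nmodType) (F : 'I_4 -> V) :
  \sum_i F i = F c1 + F c2 + F c3 + F c4.
Proof.
rewrite !big_ord_recr big_ord0 /= add0r.
by congr (F _ + F _ + F _ + F _); exact: val_inj.
Qed.

(** The arithmetic decision procedures would otherwise try to unfold the limits
    that define the derivatives. *)
Ltac generalize_partials :=
  repeat match goal with |- context [partial ?i ?F ?p] =>
    generalize (partial i F p) => ? end.

(** [A] will be a block of curvature components. Keeping it abstract prevents the
    case analysis from unfolding the curvature tensor. *)
Lemma antisym_eq0 (R : realType) (A : 'I_4 -> 'I_4 -> R) :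
  (forall i j, A i j = - A j i) -> (forall j, A c2 j = 0) ->
  A c1 c3 = 0 -> A c1 c4 = 0 -> A c3 c4 = 0 -> forall i j, A i j = 0.
Proof.
move=> anti A2 A13 A14 A34 i j.
have diag m : A m m = 0 by have := anti m m; lra.
by elim/ord4P: i; elim/ord4P: j; rewrite ?(diag, A2, A13, A14, A34)//;
  rewrite anti ?(A2, A13, A14, A34) oppr0.
Qed.

(** * The metric and its inverse *)

Local Notation transverse := [set c3; c4]%SET.

Section Metric.
Context (R : realType) (M : set 'rV[R]_4) (h f : 'rV[R]_4 -> R).
Hypotheses (M_open : open M) (M_connected : connected M).
Hypotheses (h_smooth : smooth_on M h) (f_smooth : smooth_on M f).
Hypotheses (h_dep : depends_only_on M [set c1; c3; c4]%SET h)
    (f_dep : depends_only_on M transverse f).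
Hypothesis (f_neq0 : forall p, M p -> f p != 0).
Let g := gen_pp_metric h f.

Lemma metricE p i j : g p i j =
  ((i == c1) && (j == c2) || (i == c2) && (j == c1))%:R
  + (- 2 * ((i == c1) && (j == c1))%:R) * h p
  + (- 2^-1 * ((i == c3) && (j == c3) || (i == c4) && (j == c4))%:R) * f p.
Proof.
rewrite /g /gen_pp_metric !mxE.
by elim/ord4P: i; elim/ord4P: j; rewrite /=; ring.
Qed.

Lemma metric_entry_smooth i j : smooth_on M (fun p => g p i j).
Proof.
under eq_fun do rewrite metricE.
apply: (smooth_onD M_open); last exact: (smooth_onZ M_open _ f_smooth).
apply: (smooth_onD M_open); last exact: (smooth_onZ M_open _ h_smooth).
exact: smooth_on_cst.
Qed.

Lemma metric_entry_dep i j :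
  depends_only_on M [set c1; c3; c4]%SET (fun p => g p i j).
Proof.
move=> p q Mp Mq pq; rewrite !metricE (h_dep Mp Mq pq) (f_dep Mp Mq)// => k kA.
by apply: pq; move: kA; rewrite !inE => /orP[]->; rewrite ?orbT.
Qed.

Definition gen_pp_inv p : 'M[R]_4 :=
  delta_mx c1 c2 + delta_mx c2 c1 + 2 * h p *: delta_mx c2 c2
  - 2 / f p *: (delta_mx c3 c3 + delta_mx c4 c4).

Lemma gen_pp_invE p i j : gen_pp_inv p i j =
  ((i == c1) && (j == c2) || (i == c2) && (j == c1))%:R
  + 2 * h p * ((i == c2) && (j == c2))%:R
  - 2 / f p * ((i == c3) && (j == c3) || (i == c4) && (j == c4))%:R.
Proof.
rewrite /gen_pp_inv !mxE.
by elim/ord4P: i; elim/ord4P: j; rewrite /=; ring.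
Qed.

Lemma metric_invE p : M p -> metric_inv g p = gen_pp_inv p.
Proof.
move=> Mp; have f0 := f_neq0 Mp.
have gK : g p *m gen_pp_inv p = 1%:M.
  apply/matrixP => i j; rewrite !mxE big_ord4 !metricE !gen_pp_invE.
  by elim/ord4P: i; elim/ord4P: j; rewrite /=; field.
have [gu _] := mulmx1_unit gK.
by rewrite /metric_inv -[LHS]mulmx1 -gK mulmxA mulVmx// mul1mx.
Qed.

Lemma partial_metric i p j k : M p -> partial i (fun q => g q j k) p =
  (- 2 * ((j == c1) && (k == c1))%:R) * partial i h p
  + (- 2^-1 * ((j == c3) && (k == c3) || (j == c4) && (k == c4))%:R) *
     partial i f p.
Proof.
move=> Mp; under eq_fun do rewrite metricE.
have dh := smooth_on_derivable h_smooth Mp (i := i).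
have df := smooth_on_derivable f_smooth Mp (i := i).
rewrite partialD; first last.
- exact: derivableZ.
- by apply: derivableD; [exact: derivable_cst|exact: derivableZ].
rewrite partialD; first last.
- exact: derivableZ.
- exact: derivable_cst.
by rewrite partial_cst add0r !partialZ.
Qed.

Let partial_h2 p : M p -> partial c2 h p = 0.
Proof. by apply: partial_eq0 h_dep _ => //; rewrite !inE. Qed.
Let partial_f2 p : M p -> partial c2 f p = 0.
Proof. by apply: partial_eq0 f_dep _ => //; rewrite !inE. Qed.
Let partial_f1 p : M p -> partial c1 f p = 0.
Proof. by apply: partial_eq0 f_dep _ => //; rewrite !inE. Qed.

(** * Christoffel symbols *)

(** Since the only nonzero entry of the first row of the inverse metric is
    [g^12], this symbol is the lowered symbol with first index [2]; that one
    vanishes because [g_2k] is constant and nothing depends on [r]. *)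
Lemma christoffel_upper1 i j p : M p -> christoffel g c1 i j p = 0.
Proof.
move=> Mp; rewrite /christoffel metric_invE// big1 ?mulr0// => l _.
elim/ord4P: l; rewrite gen_pp_invE /= ?(mulr0,addr0,subr0,mul0r)//.
rewrite !partial_metric// partial_h2// partial_f2//= ?andbF /=.
by generalize_partials; ring.
Qed.

(** The vanishing of these symbols says that the coordinate field of [r] is
    parallel. *)
Lemma christoffel_right2 k i p : M p -> christoffel g k i c2 p = 0.
Proof.
move=> Mp; rewrite /christoffel big1 ?mulr0// => l _.
rewrite !partial_metric// partial_h2// partial_f2//= ?andbF /=.
by generalize_partials; ring.
Qed.

Lemma christoffel_left2 k j p : M p -> christoffel g k c2 j p = 0.
Proof.
move=> Mp; rewrite /christoffel big1 ?mulr0// => l _.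
rewrite !partial_metric// partial_h2// partial_f2//= ?andbF /=.
by generalize_partials; ring.
Qed.

Lemma christoffel_transverse a i j p : M p -> a \in transverse ->
  christoffel g a i j p = - (f p)^-1 *
    (partial i (fun q => g q j a) p + partial j (fun q => g q i a) p
     - partial a (fun q => g q i j) p).
Proof.
move=> Mp; rewrite /christoffel big_ord4 metric_invE// !gen_pp_invE !inE => aE.
have f0 := f_neq0 Mp.
by case/orP: aE => /eqP-> /=; generalize_partials; field.
Qed.

Lemma christoffel_transverse1 a k p : M p -> a \in transverse ->
  k != c1 -> christoffel g a c1 k p = 0.
Proof.
move=> Mp aE kn1; rewrite christoffel_transverse// !partial_metric// partial_f1//.
by move: aE; rewrite !inE (negPf kn1) => /orP[]/eqP-> /=; generalize_partials; ring.
Qed.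

(** These are the Christoffel symbols of a metric conformal to the flat plane,
    with conformal factor [f] up to a constant. *)
Lemma christoffel_transverse_block a b c p : M p -> a \in transverse ->
  b \in transverse -> c \in transverse ->
  christoffel g a b c p = (2 * f p)^-1 *
    ((a == c)%:R * partial b f p + (a == b)%:R * partial c f p
     - (b == c)%:R * partial a f p).
Proof.
move=> Mp aE bE cE; rewrite christoffel_transverse// !partial_metric//.
have f0 := f_neq0 Mp.
move: aE bE cE; rewrite !inE => /orP[]/eqP-> /orP[]/eqP-> /orP[]/eqP-> /=;
  by generalize_partials; field.
Qed.

(** * Curvature *)

(** Nothing depends on [r], and the coordinate field of [r] is parallel. *)
Lemma riemann_up_left2 j k l p : M p -> riemann_up g c2 j k l p = 0.
Proof.
move=> Mp; rewrite /riemann_up.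
have dep := depends_only_on_christoffel M_open metric_entry_dep.
rewrite (partial_eq0 M_open (dep _ _ _))//; last by rewrite !inE.
rewrite (@eq_partial _ _ _ M_open _ (fun=> 0))//; last first.
  by move=> q Mq; rewrite christoffel_left2.
rewrite partial_cst subrr add0r big1// => m _.
by rewrite !christoffel_left2// mul0r mulr0 subrr.
Qed.

(** A parallel field is annihilated by the curvature operators. *)
Lemma riemann_up_field2 i j l p : M p -> riemann_up g i j c2 l p = 0.
Proof.
move=> Mp; rewrite /riemann_up.
rewrite !(@eq_partial _ _ _ M_open (christoffel g l _ c2) (fun=> 0))//;
  try by move=> q Mq; rewrite christoffel_right2.
rewrite !partial_cst subrr add0r big1// => m _.
by rewrite !christoffel_right2// !mulr0 subrr.
Qed.

Lemma riemann_up_upper1 i j k p : M p -> riemann_up g i j k c1 p = 0.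
Proof.
move=> Mp; rewrite /riemann_up.
rewrite !(@eq_partial _ _ _ M_open (christoffel g c1 _ k) (fun=> 0))//;
  try by move=> q Mq; rewrite christoffel_upper1.
rewrite !partial_cst subrr add0r big1// => m _.
by rewrite !christoffel_upper1// !mul0r subrr.
Qed.

(** The full symbols depend on [x] through [h]; on the transverse block only
    [f] and its derivatives occur, and the dependence on [x] disappears. *)
Lemma christoffel_transverse_dep a b c : a \in transverse ->
  b \in transverse -> c \in transverse ->
  depends_only_on M transverse (christoffel g a b c).
Proof.
move=> aE bE cE p q Mp Mq pq; rewrite !christoffel_transverse_block//.
rewrite (f_dep Mp Mq pq).
by do ![rewrite (depends_only_on_partial M_open _ f_dep Mp Mq pq)].
Qed.

Lemma riemann_up_1_transverse b k l p : M p -> b \in transverse ->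
  k \in transverse -> l \in transverse ->
  riemann_up g c1 b k l p = 0.
Proof.
move=> Mp bT kT lT; rewrite /riemann_up.
have kn1 : k != c1 by move: kT; rewrite !inE => /orP[]/eqP->.
rewrite (partial_eq0 M_open (christoffel_transverse_dep lT bT kT))//; last first.
  by rewrite !inE.
rewrite (@eq_partial _ _ _ M_open (christoffel g l c1 k) (fun=> 0))//; last first.
  by move=> q Mq; exact: christoffel_transverse1.
rewrite partial_cst subrr add0r big_ord4 !(christoffel_upper1 _ _ Mp).
rewrite !(christoffel_right2 _ _ Mp) (christoffel_transverse1 Mp lT (k := c3))//.
rewrite (christoffel_transverse1 Mp lT (k := c4))//.
rewrite (christoffel_transverse1 (a := c3) Mp _ kn1) ?inE//.
rewrite (christoffel_transverse1 (a := c4) Mp _ kn1) ?inE//.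
by rewrite !(mulr0, mul0r, subr0, addr0).
Qed.

Lemma partial_half_div F i p : M p -> derivable F p (delta_mx 0 i) ->
  partial i (fun q => (2 * f q)^-1 * F q) p =
  (2 * f p)^-1 * partial i F p - 2^-1 * (f p)^-2 * partial i f p * F p.
Proof.
move=> Mp dF; have f0 := f_neq0 Mp.
have df := smooth_on_derivable f_smooth Mp (i := i).
have d2f : derivable (fun q => 2 * f q) p (delta_mx 0 i) by exact: derivableZ.
pose f2 q := 2 * f q.
have f20 : f2 p != 0 by rewrite mulf_neq0.
rewrite [LHS](partialM (derivableV (f := f2) f20 d2f) dF).
rewrite (partialV (F := f2) f20 d2f) [partial i f2 p](partialZ 2 df) /f2.
move: (partial i F p) (partial i f p) => ? ?.
by field.
Qed.

Hypothesis f_eq : forall p, M p ->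
       partial c3 f p ^+ 2 + partial c4 f p ^+ 2
       - f p * (partial c3 (partial c3 f) p + partial c4 (partial c4 f) p)
       = 0.

(** This component is, up to a nowhere vanishing factor, the Gauss curvature of the
    transverse plane, hence also the Laplacian of [ln |f|]; the equation assumed
    of [f] says precisely that [ln |f|] is harmonic. *)
Lemma riemann_up_34 k l p : M p ->
  k \in transverse -> l \in transverse -> k != l ->
  riemann_up g c3 c4 k l p = 0.
Proof.
move=> Mp kT lT kl; rewrite /riemann_up.
have f0 := f_neq0 Mp.
have T3 : c3 \in transverse by rewrite !inE.
have T4 : c4 \in transverse by rewrite !inE.
have chr a b c := christoffel_transverse_block Mp (a := a) (b := b) (c := c).
have d i j : derivable (partial i f) p (delta_mx 0 j).
  exact: smooth_on_derivable (smooth_on_partial i f_smooth) Mp.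
have dN i j : derivable (fun q => -1 * partial i f q) p (delta_mx 0 j).
  exact: derivableZ.
rewrite big_ord4 !(christoffel_upper1 _ _ Mp) !(christoffel_right2 _ _ Mp).
rewrite !(mul0r, mulr0) !chr//.
move: kT lT kl; rewrite !inE => /orP[]/eqP-> /orP[]/eqP->; rewrite ?eqxx // => _.
- rewrite (@eq_partial _ _ _ M_open (christoffel g c4 c4 c3)
    (fun q => (2 * f q)^-1 * partial c3 f q))//; last first.
    by move=> q Mq; rewrite christoffel_transverse_block//=; generalize_partials; ring.
  rewrite (@eq_partial _ _ _ M_open (christoffel g c4 c3 c3)
    (fun q => (2 * f q)^-1 * (-1 * partial c4 f q)))//; last first.
    by move=> q Mq; rewrite christoffel_transverse_block//=; generalize_partials; ring.
  rewrite !partial_half_div// partialZ//=.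
  (* This component is [- 1 / (2 f^2)] times the left-hand side of the equation
     assumed of [f]; exchanging [k] and [l] changes the sign. *)
  have /(congr1 (fun t => - (2 * f p ^+ 2)^-1 * t))/= := f_eq Mp.
  by rewrite mulr0 => E0; rewrite -[RHS]E0; generalize_partials; field.
- rewrite (@eq_partial _ _ _ M_open (christoffel g c3 c4 c4)
    (fun q => (2 * f q)^-1 * (-1 * partial c3 f q)))//; last first.
    by move=> q Mq; rewrite christoffel_transverse_block//=; generalize_partials; ring.
  rewrite (@eq_partial _ _ _ M_open (christoffel g c3 c3 c4)
    (fun q => (2 * f q)^-1 * partial c4 f q))//; last first.
    by move=> q Mq; rewrite christoffel_transverse_block//=; generalize_partials; ring.
  rewrite !partial_half_div// partialZ//=.
  have /(congr1 (fun t => (2 * f p ^+ 2)^-1 * t))/= := f_eq Mp.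
  by rewrite mulr0 => E0; rewrite -[RHS]E0; generalize_partials; field.
Qed.

Lemma riemann_left2 j k l p : M p -> riemann g c2 j k l p = 0.
Proof.
move=> Mp; rewrite /riemann big1// => m _.
by rewrite riemann_up_left2// mul0r.
Qed.

Lemma riemann_right2 i k l p : M p -> riemann g i c2 k l p = 0.
Proof. by move=> Mp; rewrite riemann_anti riemann_left2// oppr0. Qed.

(** Up to antisymmetry the only pairs [(i, j)] to consider are those containing
    [2], and [(1, 3)], [(1, 4)], [(3, 4)]. *)
Lemma riemann_up_transverse i j k l p : M p ->
  k \in transverse -> l \in transverse -> k != l ->
  riemann_up g i j k l p = 0.
Proof.
move=> Mp kT lT kl.
have T3 : c3 \in transverse by rewrite !inE.
have T4 : c4 \in transverse by rewrite !inE.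
have anti i' j' := riemann_up_anti g i' j' k l p.
have r2x m : riemann_up g c2 m k l p = 0 by exact: riemann_up_left2.
have r13 : riemann_up g c1 c3 k l p = 0 by exact: riemann_up_1_transverse.
have r14 : riemann_up g c1 c4 k l p = 0 by exact: riemann_up_1_transverse.
have r34 : riemann_up g c3 c4 k l p = 0 by exact: riemann_up_34.
exact: (@antisym_eq0 _ (fun i j => riemann_up g i j k l p)).
Qed.

(** The curvature is concentrated on components whose last two indices contain
    the index [1]. Distinct [a] and [b] suffice, because after raising
    a repeated index meets a factor that vanishes by antisymmetry; this way the
    symmetry of the second derivatives of [f] never enters. *)
Lemma riemann_eq0_avoiding1 i j a b p : M p -> a != c1 -> b != c1 -> a != b ->
  riemann g i j a b p = 0.
Proof.
move=> Mp a1 b1 ab; rewrite /riemann big1// => m _.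
have [->|a2] := eqVneq a c2; first by rewrite riemann_up_field2// mul0r.
have [->|b2] := eqVneq b c2.
  have [->|m1] := eqVneq m c1; first by rewrite riemann_up_upper1// mul0r.
  rewrite [X in _ * X](_ : _ = 0) ?mulr0// metricE (negPf m1) !andbF /=; ring.
have [->|mb] := eqVneq m b.
  rewrite riemann_up_transverse ?mul0r//.
    by move: a1 a2 {ab}; elim/ord4P: a; rewrite ?inE.
  by move: b1 b2 {ab}; elim/ord4P: b; rewrite ?inE.
rewrite [X in _ * X](_ : _ = 0) ?mulr0// metricE.
move: b1 b2 mb {ab}; elim/ord4P: b => // _ _ /negPf mb;
  rewrite mb /= ?andbF /=; ring.
Qed.

(** Each term of the double sum vanishes. The index [a] or [b] equal to [2], or
    [a = b], makes the second factor vanish. Otherwise raising the last two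
    indices of the first factor cannot produce [a] and [b] from a pair
    containing [1], because [g^a1] is nonzero for [a = 2] only. *)
Lemma curvature_square_eq0 p : M p -> forall i j k l,
  \sum_a \sum_b riemann_raised g i j a b p * riemann g a b k l p = 0.
Proof.
move=> Mp i j k l; rewrite big1// => a _; rewrite big1// => b _.
have [->|ab] := eqVneq a b; first by rewrite riemann_diag12 mulr0.
have [->|a2] := eqVneq a c2; first by rewrite riemann_left2// mulr0.
have [->|b2] := eqVneq b c2; first by rewrite riemann_right2// mulr0.
rewrite /riemann_raised big1 ?mul0r// => c _; rewrite big1// => d _.
have [[c1E d1E cdE]|[]] : [/\ c != c1, d != c1 & c != d] \/
    (gen_pp_inv p a c = 0 \/ gen_pp_inv p b d = 0).
  rewrite !gen_pp_invE.
  move: ab a2 b2.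
  elim/ord4P: a => //; elim/ord4P: b => // _ _ _;
  elim/ord4P: c => /=; rewrite ?(mulr0, subr0, addr0); try (by right; left);
  elim/ord4P: d => /=; rewrite ?(mulr0, subr0, addr0); try (by right; right);
  by left.
- by rewrite riemann_eq0_avoiding1// mulr0.
- by rewrite metric_invE// => ->; rewrite !mul0r.
- by rewrite metric_invE// => ->; rewrite mulr0 mul0r.
Qed.

(** * Signature and parallel null field *)

(** The image of the connected set [M] under [f] is an interval that misses
    [0]. *)
Lemma f_constant_sign :
  exists2 s : R, s = 1 \/ s = -1 & forall p, M p -> 0 < s * f p.
Proof.
have img_itv : is_interval (f @` M).
  apply/connected_intervalP/connected_continuous_connected => //.
  apply: continuous_in_subspaceT => p /set_mem Mp.
  by have [] := f_smooth [::] Mp.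
have [[p Mp fp]|npos] := pselect (exists2 p, M p & 0 < f p).
  exists 1; first by left.
  move=> q Mq; rewrite mul1r ltNge; apply/negP => fq.
  have [z Mz fz] : (f @` M) 0.
    by apply: (img_itv (f q) (f p)); [exists q|exists p|rewrite fq ltW].
  by move: (f_neq0 Mz); rewrite fz eqxx.
exists (-1); first by right.
move=> q Mq; rewrite mulN1r oppr_gt0 lt_neqAle f_neq0//= leNgt.
by apply/negP => fq; apply: npos; exists q.
Qed.

(** The first two rows of [P] form an orthonormal basis of the plane of [x] and
    [r] and the last two rescale the transverse plane. Their squared
    norms are [s], [- s], [- s], [- s], so that the sign [s] of [f] fixes the sign
    convention of the signature. *)
Lemma metric_congruent (s : R) p : s = 1 \/ s = -1 -> 0 < s * f p ->
  congruent_mx (g p) (s *: minkowski_mx R 3).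
Proof.
move=> s1 sf.
have s0 : s != 0 by case: s1 => ->; rewrite ?oppr_eq0 oner_eq0.
have ss : s ^+ 2 = 1 by case: s1 => ->; rewrite ?sqrrN expr1n.
pose r := Num.sqrt (2 / (s * f p)).
have rr : r ^+ 2 * f p = 2 * s.
  rewrite sqr_sqrtr; last by rewrite divr_ge0// ltW.
  have f0 : f p != 0 by apply: contraTneq sf => ->; rewrite mulr0 ltxx.
  have sV : s^-1 = s by case: s1 => ->; rewrite ?invrN1 ?invr1.
  by rewrite -{2}sV; field; rewrite s0 f0.
pose P : 'M[R]_4 := delta_mx c1 c1 + (h p + s / 2) *: delta_mx c1 c2
  + delta_mx c2 c1 + (h p - s / 2) *: delta_mx c2 c2
  + r *: delta_mx c3 c3 + r *: delta_mx c4 c4.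
have PE i j : P i j = ((i == c1) && (j == c1))%:R
  + (h p + s / 2) * ((i == c1) && (j == c2))%:R
  + ((i == c2) && (j == c1))%:R
  + (h p - s / 2) * ((i == c2) && (j == c2))%:R
  + r * ((i == c3) && (j == c3))%:R + r * ((i == c4) && (j == c4))%:R.
  by rewrite !mxE.
have PgP : P *m g p *m P^T = s *: minkowski_mx R 3.
  apply/matrixP => i j; rewrite !mxE big_ord4 !mxE !big_ord4.
  rewrite !metricE !PE.
  elim/ord4P: i; elim/ord4P: j; rewrite /= ?mulr1n ?mulr0n; nra.
exists P => //.
have : P *m g p *m P^T \in unitmx.
  rewrite PgP unitmxE detZ unitrM unitfE expf_neq0//= det_diag.
  by rewrite unitfE; apply/prodf_neq0 => i _; rewrite mxE; case: ifP => _;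
    rewrite ?oppr_eq0 oner_eq0.
by rewrite !unitmx_mul => /andP[/andP[]].
Qed.

Lemma gen_pp_metric_lorentzian : lorentzian_on M g.
Proof.
split; first exact: metric_entry_smooth.
  move=> p Mp; apply/matrixP => i j; rewrite mxE !metricE.
  by elim/ord4P: i; elim/ord4P: j.
have [s s1 sf] := f_constant_sign.
have [sE|sE] := s1; [left|right] => p Mp.
  by have := metric_congruent s1 (sf _ Mp); rewrite sE scale1r.
by have := metric_congruent s1 (sf _ Mp); rewrite sE scaleN1r.
Qed.

Lemma gen_pp_metric_brinkmann : brinkmann_wave_on M g.
Proof.
split; first exact: gen_pp_metric_lorentzian.
exists (fun=> delta_mx 0 c2); split.
- by move=> k; exact: smooth_on_cst.
- move=> p _; apply/eqP => /matrixP/(_ 0 c2); rewrite !mxE !eqxx /=.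
  by apply/eqP; rewrite oner_eq0.
- move=> p Mp; rewrite !big_ord4 !metricE !mxE /=; ring.
- move=> p Mp i k; rewrite /cov_deriv partial_cst add0r big1// => j _.
  rewrite mxE eqxx /=; case: eqP => [->|_]; last by rewrite mulr0.
  by rewrite christoffel_right2// mul0r.
Qed.

End Metric.

Theorem theorem3p2 (R : realType) (M : set 'rV[R]_4) (h f : 'rV[R]_4 -> R)
    (M_open : open M) (M_connected : connected M)
    (h_smooth : smooth_on M h) (f_smooth : smooth_on M f)
    (h_dep : depends_only_on M [set c1; c3; c4]%SET h)
    (f_dep : depends_only_on M [set c3; c4]%SET f)
    (h_neq0 : forall p, M p -> h p != 0)
    (f_neq0 : forall p, M p -> f p != 0)
    (f_eq : forall p, M p ->
       partial c3 f p ^+ 2 + partial c4 f p ^+ 2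
       - f p * (partial c3 (partial c3 f) p + partial c4 (partial c4 f) p)
       = 0) :
  pp_wave_on M (gen_pp_metric h f).
Proof.
split; first exact: gen_pp_metric_brinkmann.
move=> p Mp.
exact: (curvature_square_eq0 M_open h_smooth f_smooth h_dep f_dep f_neq0 f_eq).
Qed.
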